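(* Let $d\equiv 2\pmod 4$ be a positive integer which is not square-free. Then $M_{even}(d)\leq 2$ if and only if $d=18$.
   Context: For an integer $n\geq 2$, $\omega(n)$ denotes the number of distinct prime divisors of $n$. For an integer $d\geq 4$, $M_{even}(d):=\max\{\omega(d+x^2) : x \text{ an even integer with } 2\leq x\leq\sqrt d\}$. *)

(* Defs.v *)
From mathcomp Require Import all_boot.

Set Implicit Arguments.
Unset Strict Implicit.
Unset Printing Implicit Defensive.

Definition omega (n : nat) : nat := size (primes n).

Definition squarefree (n : nat) : Prop := forall k : nat, k ^ 2 %| n -> k = 1.

(* On natural numbers, x <= sqrt d is expressed as x ^ 2 <= d. The bound
   x < d.+1 only makes the range finite: x ^ 2 <= d already implies x <= d.
   For d >= 4 the range contains x = 2, so the value 0 that \max gives on an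
   empty range does not occur there. *)
Definition M_even (d : nat) : nat :=
  \max_(2 <= x < d.+1 | ~~ odd x && (x ^ 2 <= d)) omega (d + x ^ 2).

(* Main.v *)
Require Import Defs.
From mathcomp Require Import all_boot.
From mathcomp Require Import zify.

(** Write [d = 2 * m] with [m] odd and [x = 2 * y], so that
    [d + x ^ 2 = 2 * (m + 2 * y ^ 2)] with an odd second factor.  Hence
    [M_even d <= 2] forces every [m + 2 * y ^ 2] with [0 < y] and
    [2 * y ^ 2 <= m] to be a prime power ([prime_power_of_M_even]).

    The contradiction comes from an odd [n] such that [n + 2] and [n + 8] are
    powers of one and the same prime: the smaller power divides the larger
    one, hence divides their difference 6, and this leaves only [n = 1]
    ([pnat_add2_add8]).  As [d] is not square-free and 4 does not divide it,
    [m = k * p ^ 2] for an odd prime [p].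
    - If [1 < k], the choices [y = p] and [y = 2 * p] give the values
      [p ^ 2 * (k + 2)] and [p ^ 2 * (k + 8)], so that both [k + 2] and [k + 8]
      are powers of [p], which is impossible.  The choice [y = 2 * p] requires
      [8 <= k]; for [k] equal to 3, 5 or 7 the fact that [k + 2] is a power of
      [p] determines [p], and [m + 2] is one of 77, 247 and 65, none of them a
      prime power.
    - If [k = 1] and [p <> 3], then 3 divides [p ^ 2 + 2] and [p ^ 2 + 8], the
      values at [y = 1] and [y = 2], so both are powers of 3: impossible.
    - If [k = 1] and [p = 3], then [d = 18], where the values at [x = 2] and
      [x = 4] are [22 = 2 * 11] and [34 = 2 * 17]. *)

(** Of two powers of [p] the smaller divides the larger, so [n + 2] divides 6;
    being odd and at least 3, it is 3.  The case [n = 1] does occur, with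
    [p = 3] and the powers 3 and 9. *)
Lemma pnat_add2_add8 (p n : nat) :
  prime p -> odd n -> p.-nat (n + 2) -> p.-nat (n + 8) -> n = 1.
Proof.
move=> p_pr n_odd /p_natP[a Ea] /p_natP[b Eb].
have le_ab : a <= b by rewrite -(leq_exp2l _ _ (prime_gt1 p_pr)) -Ea -Eb leq_add2l.
have : n + 2 %| 6.
  have := dvdn_exp2l p le_ab; rewrite -Ea -Eb.
  by rewrite (addnA n 2 6) dvdn_addr ?dvdnn.
move=> dv6; have := dvdn_leq (isT : 0 < 6) dv6.
by case: n n_odd dv6 {Ea Eb} => [|[|[|[|[|n]]]]] //; lia.
Qed.

(** The three primes are 2, [p] and a prime factor of [n] other than [p]. *)
Lemma omega_double_ge3 (p n : nat) :
  odd n -> prime p -> p %| n -> ~~ p.-nat n -> 2 < omega (2 * n).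
Proof.
move=> n_odd p_pr p_n; have n_gt0 := odd_gt0 n_odd.
rewrite /pnat n_gt0 /= => /allPn[q].
rewrite mem_primes n_gt0 /= => /andP[q_pr q_n]; rewrite !inE => q_p.
have ne2 r : r %| n -> 2 != r.
  by move=> r_n; apply/eqP => r2; move: r_n n_odd; rewrite -r2 dvdn2 => /negP.
apply: (@uniq_leq_size _ [:: 2; p; q]) => [|r].
  by rewrite /= !inE negb_or !ne2 //= andbT eq_sym.
rewrite !inE mem_primes muln_gt0 n_gt0 /= => /or3P[] /eqP->.
- by rewrite dvdn_mulr.
- by rewrite p_pr dvdn_mull.
- by rewrite q_pr dvdn_mull.
Qed.

Lemma prime_power_of_M_even (m y p : nat) :
    M_even (2 * m) <= 2 -> odd m -> 0 < y -> 2 * y ^ 2 <= m ->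
    prime p -> p %| m + 2 * y ^ 2 ->
  p.-nat (m + 2 * y ^ 2).
Proof.
move=> M_le2 m_odd y_gt0 y_le p_pr p_dvd; apply/contraT => np.
have N_odd : odd (m + 2 * y ^ 2) by rewrite oddD m_odd oddM.
have := omega_double_ge3 _ _ N_odd p_pr p_dvd np; rewrite ltnNge => /negP[].
have -> : 2 * (m + 2 * y ^ 2) = 2 * m + (2 * y) ^ 2.
  by rewrite expnMn mulnDr mulnA.
apply: leq_trans M_le2; rewrite /M_even.
have y2 : (2 * y) ^ 2 <= 2 * m.
  by rewrite expnMn (_ : 2 ^ 2 = 2 * 2) // -mulnA leq_mul2l.
apply: (@leq_bigmax_seq _ (index_iota 2 (2 * m).+1)
  (fun x => ~~ odd x && (x ^ 2 <= 2 * m)) (fun x => omega (2 * m + x ^ 2))).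
  by rewrite mem_index_iota; nia.
by rewrite y2 oddM.
Qed.

Lemma M_even_18 : M_even 18 = 2.
Proof. by rewrite /M_even unlock; vm_compute. Qed.

Lemma nonsquarefree_mod4_2 (d : nat) :
    0 < d -> d = 2 %[mod 4] -> ~ squarefree d ->
  exists k p, [/\ prime p, odd p, odd k & d = 2 * (k * p ^ 2)].
Proof.
move=> d_gt0 d_mod4 d_nsqf.
have [m m_odd Ed] : exists2 m, odd m & d = 2 * m by exists (d %/ 2); lia.
(* Only primes of [d] are tested, which keeps the search decidable. *)
have [/hasP[p] | /hasPn no_p] := boolP (has (fun p => p ^ 2 %| d) (primes d)).
  rewrite mem_primes => /and3P[p_pr _ _] p2_d.
  have p_odd : odd p.
    have [p2|//] := even_prime p_pr; move: p2_d; rewrite p2; lia.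
  have /dvdnP[k Em] : p ^ 2 %| m.
    by rewrite -(@Gauss_dvdr _ 2) -?Ed // coprimen2 oddX.
  by exists k, p; split; rewrite // ?Ed -?Em //; move: m_odd; rewrite Em oddM => /andP[].
case: d_nsqf => k k2_d; apply/eqP/contraT => k_neq1.
have q_pr : prime (pdiv k).
  by apply: pdiv_prime; case: k k_neq1 k2_d => [|[|]] //; lia.
have q2_d : pdiv k ^ 2 %| d by apply: dvdn_trans k2_d; rewrite dvdn_exp2r ?pdiv_dvd.
have := no_p (pdiv k); rewrite q2_d mem_primes q_pr d_gt0 => /(_ _)/negP[] //.
by apply: dvdn_trans q2_d; rewrite dvdn_exp.
Qed.

Theorem theorem6 (d : nat) (d_gt0 : 0 < d) (d_mod4 : d = 2 %[mod 4])
    (d_nsqf : ~ squarefree d) :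
  M_even d <= 2 <-> d = 18.
Proof.
split=> [M_le2 | ->]; last by rewrite M_even_18.
have [k [p [p_pr p_odd k_odd Ed]]] := nonsquarefree_mod4_2 _ d_gt0 d_mod4 d_nsqf.
have p_ge3 : 2 < p by have := prime_gt1 p_pr; case: p p_odd {p_pr Ed} => [|[|[]]].
have m_odd : odd (k * p ^ 2) by rewrite oddM k_odd oddX p_odd orbT.
have ppow y q : 0 < y -> 2 * y ^ 2 <= k * p ^ 2 -> prime q ->
    q %| k * p ^ 2 + 2 * y ^ 2 -> q.-nat (k * p ^ 2 + 2 * y ^ 2).
  by apply: prime_power_of_M_even; rewrite -?Ed.
have [k1 | k_neq1] := eqVneq k 1.
  rewrite {}k1 !mul1n in m_odd ppow Ed.
  have [p3 | p_neq3] := eqVneq p 3; first by rewrite Ed p3.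
  have p_mod3 : p ^ 2 %% 3 = 1.
    have : ~~ (3 %| p) by rewrite dvdn_prime2 // eq_sym.
    rewrite -modnXm /dvdn; have := ltn_pmod p (isT : 0 < 3).
    by case: (p %% 3) => [|[|[]]].
  have p2_ge9 : 9 <= p ^ 2 by rewrite -[9]/(3 ^ 2) leq_exp2r.
  have p2_1 : p ^ 2 = 1.
    by apply: (pnat_add2_add8 3) => //; [apply: (ppow 1) | apply: (ppow 2)] => //; lia.
  by rewrite p2_1 in p2_ge9.
have k_ge3 : 2 < k by case: k k_odd k_neq1 {Ed m_odd ppow} => [|[|[]]].
have kpow t : 0 < t -> 2 * t ^ 2 <= k -> p.-nat (k + 2 * t ^ 2).
  move=> t_gt0 t_le; have E : k * p ^ 2 + 2 * (t * p) ^ 2 = (k + 2 * t ^ 2) * p ^ 2.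
    by rewrite expnMn mulnA mulnDl.
  have: p.-nat (k * p ^ 2 + 2 * (t * p) ^ 2).
    apply: ppow => //; last by rewrite E dvdn_mull // dvdn_exp.
      by rewrite muln_gt0 t_gt0 prime_gt0.
    by rewrite expnMn mulnA leq_mul2r t_le orbT.
  by rewrite E pnatM => /andP[].
have pow2 : p.-nat (k + 2) by apply: (kpow 1); rewrite // ltnW.
have [k_ge8 | k_lt8] := leqP 8 k.
  by rewrite (pnat_add2_add8 _ _ p_pr k_odd pow2 (kpow 2 _ _)) in k_neq1.
have p_unique q : prime q -> q %| k + 2 -> p = q.
  move=> q_pr q_dvd; apply/esym/eqP; apply: (pnatPpi pow2).
  by rewrite mem_primes q_pr q_dvd addn2.
have : [\/ k = 3, k = 5 | k = 7].
  by case: k k_odd k_ge3 k_lt8 {k_neq1 Ed m_odd ppow kpow pow2 p_unique}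
    => [|[|[|[|[|[|[|[|]]]]]]]] // _ _ _; constructor.
case=> Ek; rewrite {}Ek in ppow p_unique.
- have Ep : p = 5 by apply: p_unique.
  by move: (ppow 1 7); rewrite Ep; vm_compute=> /(_ isT isT isT isT).
- have Ep : p = 7 by apply: p_unique.
  by move: (ppow 1 13); rewrite Ep; vm_compute=> /(_ isT isT isT isT).
- have Ep : p = 3 by apply: p_unique.
  by move: (ppow 1 5); rewrite Ep; vm_compute=> /(_ isT isT isT isT).
Qed.
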